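(* Let $d\in\mathbb{N}$. For any pair of sequences of positive integers $b=b(n)\to\infty$ and $k=k(n)\to\infty$ (as $n\to\infty$) satisfying $$\frac{n}{bk\log(b)+k\log(k)}\to\infty,$$ there exists an estimator $V_n\in\mathcal{H}_{d,b}^k$ such that, for all $\varepsilon>0$, $$\sup_{p\in\mathcal{D}_d}P\left(\|V_n-p\|_1>3\min_{q\in\mathcal{H}_{d,b}^k}\|p-q\|_1+\varepsilon\right)\to 0\quad (n\to\infty),$$ where $V_n$ is a function of $X_1,\ldots,X_n\overset{iid}{\sim}p$.
   Context: $\mathbb{N}$ denotes the positive integers and $[b]=\{1,\ldots,b\}$. $\mathcal{D}_d$ is the set of all probability densities on $[0,1)^d$ (with respect to $d$-dimensional Lebesgue measure); $\|\cdot\|_1$ is the $L^1$ norm. $\Delta_k$ is the set of vectors in $\mathbb{R}^k$ with nonnegative entries summing to one. For $i\in[b]$, let $h_{1,b,i}(x)=b\,\mathbf{1}\left(\frac{i-1}{b}\le x<\frac{i}{b}\right)$ on $[0,1)$, and let $\mathcal{H}_{1,b}$ be the convex hull of $\{h_{1,b,i}: i\in[b]\}$ (one-dimensional histograms with $b$ bins). For univariate functions, $\prod_{j=1}^d p_j$ denotes $(x_1,\ldots,x_d)\mapsto\prod_{j=1}^d p_j(x_j)$. The set of multi-view histograms with $b$ bins per dimension and at most $k$ separable components is $$\mathcal{H}_{d,b}^k=\left\{\sum_{i=1}^k w_i\prod_{j=1}^d p_{i,j}\;:\; w\in\Delta_k,\ p_{i,j}\in\mathcal{H}_{1,b}\right\}.$$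 An estimator $V_n\in\mathcal{H}_{d,b}^k$ is a function of the sample (not depending on $p$) with values in $\mathcal{H}_{d,b}^k$. *)

(* Defs.v *)
From HB Require Import structures.
From mathcomp Require Import all_boot all_order all_algebra.
From mathcomp Require Import all_classical all_reals all_analysis.
From mathcomp Require Import measurable_realfun.

Set Implicit Arguments.
Unset Strict Implicit.
Unset Printing Implicit Defensive.

Import Order.TTheory GRing.Theory Num.Theory.
Import numFieldNormedType.Exports.

Local Open Scope classical_set_scope.
Local Open Scope ring_scope.

Section power_measure.
Context {disp} {T : measurableType disp} {R : realType}.

Definition tcons n (xt : T * n.-tuple T) : n.+1.-tuple T :=
  [the n.+1.-tuple T of xt.1 :: xt.2].

Lemma measurable_tcons n : measurable_fun [set: T * n.-tuple T] (@tcons n).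
Proof. exact: measurable_cons. Qed.

Definition power_step n (mu : {sigma_finite_measure set T -> \bar R})
    (nu : {sigma_finite_measure set (n.-tuple T) -> \bar R}) :
    set (n.+1.-tuple T) -> \bar R :=
  pushforward (mu \x nu)%E (@tcons n).

Section step.
Variables (n : nat) (mu : {sigma_finite_measure set T -> \bar R}).
Variable nu : {sigma_finite_measure set (n.-tuple T) -> \bar R}.

Let m := measure_function_pushforward__canonical__measure_function_Measure
  (mu \x nu)%E (@measurable_tcons n).

Let power_step0 : power_step mu nu set0 = 0%E.
Proof. exact: (measure0 m). Qed.

Let power_step_ge0 A : (0 <= power_step mu nu A)%E.
Proof. exact: (measure_ge0 m). Qed.

Let power_step_sigma_additive : semi_sigma_additive (power_step mu nu).
Proof. exact: (@measure_semi_sigma_additive _ _ _ m). Qed.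

HB.instance Definition _ := isMeasure.Build _ _ _ (power_step mu nu)
  power_step0 power_step_ge0 power_step_sigma_additive.

(* Not inferable: the library's canonical sigma-finiteness instance on products
   only covers subprobability factors. *)
Let product_sigma_finite : sigma_finite setT (mu \x nu)%E.
Proof.
have /sigma_finiteP[F [TF ndF Foo]] := sigma_finiteT mu.
have /sigma_finiteP[G [TG ndG Goo]] := sigma_finiteT nu.
exists (fun k => F k `*` G k).
  rewrite -setXTT TF TG; apply/seteqP; split => -[x y] /=; last first.
    by move=> [k _ []/= ? ?]; split; exists k.
  move=> [/= [i _ Fix_] [j _ Gjy]]; exists (maxn i j) => //; split => /=.
    by move: x Fix_; exact/subsetPset/ndF/leq_maxl.
  by move: y Gjy; exact/subsetPset/ndG/leq_maxr.
move=> k; have [? ?] := Foo k; have [? ?] := Goo k.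
split; first exact: measurableX.
by rewrite product_measure1E// lte_mul_pinfty// ge0_fin_numE.
Qed.

Let power_step_sigma_finite : sigma_finite setT (power_step mu nu).
Proof.
have [F TF Foo] := product_sigma_finite.
pose u (t : n.+1.-tuple T) : T * n.-tuple T := (thead t, [tuple of behead t]).
have tK : cancel (@tcons n) u.
  by case=> x t; rewrite /u /tcons; congr pair; exact/val_inj.
have mu_ : measurable_fun setT u.
  apply/measurable_fun_pair; first exact: measurable_tnth.
  exact: measurable_behead.
exists (fun k => u @^-1` F k).
  by rewrite -preimage_bigcup -TF preimage_setT.
move=> k; have [mF oF] := Foo k; split.
  by rewrite -[X in measurable X]setTI; exact: mu_.
rewrite /power_step /pushforward -comp_preimage.
by rewrite (_ : u \o _ = id)//; apply/funext => x /=; exact: tK.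
Qed.

HB.instance Definition _ := Measure_isSigmaFinite.Build _ _ _
  (power_step mu nu) power_step_sigma_finite.

End step.

(* n-fold product of mu, transported from T * (T * ...) to n-tuples: the
   library only provides binary products of measures. *)
Fixpoint power_measure (mu : {sigma_finite_measure set T -> \bar R}) n :
    {sigma_finite_measure set (n.-tuple T) -> \bar R} :=
  match n with
  | 0 => dirac [tuple]
  | n'.+1 => power_step mu (power_measure mu n')
  end.

Lemma measurable_box n (A : 'I_n -> set T) : (forall i, measurable (A i)) ->
  measurable [set t : n.-tuple T | forall i, A i (tnth t i)].
Proof.
move=> mA.
rewrite (_ : mkset _ = \bigcap_(i in [set: 'I_n]) ((tnth (T:=T))^~ i @^-1` A i)).
  apply: fin_bigcap_measurable; first exact: finite_finset.
  move=> i _; rewrite -[X in measurable X]setTI.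
  exact: measurable_tnth.
by apply/seteqP; split => [t tA i _|t tA i]; [exact: tA|exact: (tA i)].
Qed.

Lemma power_measure_box (mu : {sigma_finite_measure set T -> \bar R})
    n (A : 'I_n -> set T) : (forall i, measurable (A i)) ->
  power_measure mu n [set t | forall i, A i (tnth t i)] =
  (\prod_(i < n) mu (A i))%E.
Proof.
elim: n A => [|n IHn] A mA.
  by rewrite big_ord0 /= diracE mem_set// => -[].
pose B := [set t : n.-tuple T | forall i, A (lift ord0 i) (tnth t i)].
have mB : measurable B := measurable_box (fun i => mA (lift ord0 i)).
rewrite big_ord_recl -(IHn (fun i => A (lift ord0 i)))//.
rewrite -[RHS](product_measure1E mu (power_measure mu n) (mA ord0) mB).
rewrite /= /power_step /pushforward; congr (_ _).
apply/seteqP; split => -[x t] /= h.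
  by split => [|i]; [exact: (h ord0)|have := h (lift ord0 i); rewrite tnthS].
by move=> i; case: (unliftP ord0 i) => [j|] ->; [rewrite tnthS; exact: h.2|exact: h.1].
Qed.

End power_measure.

Section densities.
Context {R : realType} (d : nat).

(* Coordinates live in measurableTypeR R, i.e. R with the Borel sigma-algebra on
   which lebesgue_measure is declared. *)
Definition lebesgue : {sigma_finite_measure set (d.-tuple (measurableTypeR R)) -> \bar R} :=
  power_measure (@lebesgue_measure R) d.

Definition cube : set (d.-tuple (measurableTypeR R)) :=
  [set x | forall i, 0 <= (tnth x i : R) < 1].

Lemma measurable_cube : measurable cube.
Proof.
rewrite /cube.
rewrite (_ : mkset _ = [set x | forall i, `[(0 : R), 1[%classic (tnth x i)]).
  apply: (@measurable_box _ (measurableTypeR R) d (fun=> `[(0 : R), 1[%classic)) => i.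
  exact: measurable_itv.
by apply/seteqP; split => x /= cx i; have := cx i; rewrite in_itv.
Qed.

(* Only the values on the cube matter. *)
Record density := Density {
  pdf :> d.-tuple (measurableTypeR R) -> R;
  measurable_pdf : measurable_fun cube pdf;
  pdf_ge0 : forall x, cube x -> 0 <= pdf x;
  integral_pdf : (\int[lebesgue]_(x in cube) (pdf x)%:E = 1)%E }.

Definition law (p : density) : set (d.-tuple (measurableTypeR R)) -> \bar R :=
  fun A => (\int[lebesgue]_(x in A `&` cube) (p x)%:E)%E.

Section law_probability.
Variable p : density.

Let law0 : law p set0 = 0%E.
Proof. by rewrite /law set0I integral_set0. Qed.

Let law_ge0 A : (0 <= law p A)%E.
Proof. by apply: integral_ge0 => x [_ cx]; rewrite lee_fin pdf_ge0. Qed.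

Let law_sigma_additive : semi_sigma_additive (law p).
Proof.
move=> F mF tF mUF; rewrite /law; apply: cvg_toP.
  apply: ereal_nondecreasing_is_cvgn => m n mn.
  apply: lee_sum_nneg_natr => // k _ _; exact: law_ge0.
rewrite setI_bigcupl ge0_integral_bigcup//=.
- by move=> k; apply: measurableI => //; exact: measurable_cube.
- apply/measurable_EFinP; apply: measurable_funS (measurable_pdf p).
    exact: measurable_cube.
  by move=> x [k _ []].
- by move=> x [k _ [_ cx]]; rewrite lee_fin pdf_ge0.
- exact: trivIset_setIr.
Qed.

HB.instance Definition _ := isMeasure.Build _ _ _ (law p)
  law0 law_ge0 law_sigma_additive.

Let law_setT : law p [set: _] = 1%E.
Proof. by rewrite /law setTI integral_pdf. Qed.

HB.instance Definition _ := Measure_isProbability.Build _ _ _ (law p) law_setT.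

End law_probability.

(* Joint law of n i.i.d. points drawn from p. *)
Definition iid_law (p : density) n :
    {sigma_finite_measure set (n.-tuple (d.-tuple (measurableTypeR R))) -> \bar R} :=
  power_measure (law p) n.

Lemma iid_law_setT (p : density) n : iid_law p n [set: _] = 1%E.
Proof.
have := power_measure_box (law p) (A := fun _ : 'I_n => setT)
  (fun=> measurableT).
rewrite big1 => [<-|i _]; last exact: probability_setT.
by congr (_ _); apply/esym/seteqP; split.
Qed.

Definition L1_dist (f g : d.-tuple (measurableTypeR R) -> R) : \bar R :=
  (\int[lebesgue]_(x in cube) `|f x - g x|%:E)%E.

(* For multi-view histograms the infimum is a minimum: the parameters range over
   a compact set. *)
Definition L1_error (H : set (d.-tuple (measurableTypeR R) -> R)) (p : d.-tuple (measurableTypeR R) -> R) :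
    \bar R :=
  ereal_inf [set L1_dist p q | q in H].

(* Joint measurability makes the probability of events such as
   "L1_dist (V s) p > c" meaningful (by Tonelli). *)
Definition estimator n (H : set (d.-tuple (measurableTypeR R) -> R))
    (V : n.-tuple (d.-tuple (measurableTypeR R)) -> d.-tuple (measurableTypeR R) -> R) : Prop :=
  (forall s, H (V s)) /\
  measurable_fun [set: n.-tuple (d.-tuple (measurableTypeR R)) * d.-tuple (measurableTypeR R)]
    (fun sx => V sx.1 sx.2).

End densities.

Section histograms.
Context {R : realType}.

Definition simplex k : set ('I_k -> R) :=
  [set w | (forall i, 0 <= w i) /\ \sum_(i < k) w i = 1].

Definition convex_hull (S : set (R -> R)) : set (R -> R) :=
  [set f | exists m (w : 'I_m -> R) (g : 'I_m -> R -> R),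
    [/\ simplex w, forall i, S (g i)
      & f = fun x => \sum_(i < m) w i * g i x]].

(* Bins are numbered from 0; the functions vanish outside [0, 1). *)
Definition bin_density b (i : 'I_b) : R -> R :=
  fun x => b%:R * \1_(`[i%:R / b%:R, i.+1%:R / b%:R[%classic) x.

Definition histogram1 b : set (R -> R) := convex_hull (range (@bin_density b)).

Definition multiview_histogram d b k : set (d.-tuple (measurableTypeR R) -> R) :=
  [set f | exists (w : 'I_k -> R) (p : 'I_k -> 'I_d -> R -> R),
    [/\ simplex w, forall i j, histogram1 b (p i j)
      & f = fun x => \sum_(i < k) w i * \prod_(j < d) p i j (tnth x j)]].

End histograms.
Arguments multiview_histogram {R}.

(* Main.v *)
Require Import Defs.
From HB Require Import structures.
From mathcomp Require Import all_boot all_order all_algebra.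
From mathcomp Require Import all_classical all_reals all_analysis.
From mathcomp Require Import measurable_realfun.
From mathcomp Require Import ring lra.
Import Order.TTheory GRing.Theory Num.Theory.
Import numFieldNormedType.Exports.

Set Implicit Arguments.
Unset Strict Implicit.
Unset Printing Implicit Defensive.

Local Open Scope classical_set_scope.
Local Open Scope ring_scope.

(** A multi-view histogram is constant on each of the [b ^ d] cells of the regular
    partition of the cube, so it is determined by the probabilities of the cells,
    which are polynomials in the mixture weights and bin probabilities
    ([multiview_histogramP]). The parameters form a product of simplices, on which
    the [L1] distance to [p] is continuous; compactness gives the minimizer
    ([best_approximation]).

    For the estimator, the parameters are rounded at resolutions [k ^ -2] and
    [b ^ -2]. One histogram is kept per code, which gives a finite net with
    accuracy [1 / k + d / b] in [L1] ([net_exists]) and logarithmic size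
    [O (b k log b + k log k)] ([card_code_le]). The estimator is Yatracos' minimum
    distance rule over this net: for every pair [q, q'] of the net consider the
    set [q' < q], and select the member whose masses on all these sets are closest
    to the empirical frequencies. As the [L1] distance of two members is twice
    their mass difference on one of the sets, the selected member satisfies
    [|V - p| <= 3 |q - p| + 4 D] for every [q] in the net, where [D] is the largest
    deviation of the frequencies from the probabilities under [p]
    ([min_distance_oracle], [word_estimate_error]).

    A Chernoff bound and a union bound control [D] uniformly in [p]
    ([max_deviation_tail]): the probability that [D > t] is at most the squared
    size of the net times [2 exp (- n t^2 / 8)], and this tends to zero because
    the logarithmic size is [o(n)]. The sets are unions of cells, so only the
    cells of the sample points matter: the probabilistic part is a computation on
    words over a finite alphabet ([chernoff]), and independence enters only
    through the product formula for boxes ([power_measure_sample_word]). *)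

(** * Empirical frequencies over a finite alphabet *)

Section EmpiricalFrequency.
Context {R : realType} {C : finType}.
Implicit Types (P : C -> R) (A : {set C}).

Definition prob_vector P := (forall a, 0 <= P a) /\ \sum_a P a = 1.

Definition mass P A : R := \sum_(a in A) P a.

Definition freq n (s : {ffun 'I_n -> C}) A : R :=
  (\sum_i (s i \in A)%:R) / n%:R.

Lemma mass_ge0 P A : prob_vector P -> 0 <= mass P A.
Proof. by move=> [P0 _]; apply: sumr_ge0. Qed.

Lemma mass_setC P A : prob_vector P -> mass P (~: A) = 1 - mass P A.
Proof.
move=> [_ <-]; rewrite (bigID (mem A))/= addrC addrK.
by apply: eq_bigl => a; rewrite inE.
Qed.

Lemma mass_le1 P A : prob_vector P -> mass P A <= 1.
Proof.
by move=> pP; rewrite -subr_ge0 -mass_setC//; exact: mass_ge0.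
Qed.

Lemma freq_setC n (s : {ffun 'I_n -> C}) A : (0 < n)%N ->
  freq s (~: A) = 1 - freq s A.
Proof.
move=> n0; rewrite /freq.
have nN0 : n%:R != 0 :> R by rewrite pnatr_eq0 -lt0n.
rewrite -[X in X - _](divff nN0) -mulrBl; congr (_ / _).
rewrite -[X in X%:R](card_ord n) -sum1_card natr_sum -sumrB.
by apply: eq_bigr => i _; rewrite inE; case: (_ \in _); rewrite ?subrr ?subr0.
Qed.

Lemma expR_le_quadratic (x : R) : 0 <= x -> 2 * x <= 1 ->
  expR x <= 1 + x + 2 * x ^+ 2.
Proof.
move=> x0 x1.
(* [expR (- x) >= 1 - x], and [(1 - x) (1 + x + 2 x^2) >= 1] on this range. *)
have h3 : 0 < 1 - x by lra.
rewrite -(ler_pM2r h3) (@le_trans _ _ 1)//.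
  rewrite -[leRHS](expRxMexpNx_1 x) ler_wpM2l ?expR_ge0//.
  exact: expR_ge1Dx.
rewrite mulrC -subr_ge0 (_ : _ - _ = x ^+ 2 * (1 - 2 * x)); last by ring.
by rewrite mulr_ge0 ?sqr_ge0 ?subr_ge0.
Qed.

(** Exponential Markov inequality with parameter [l = t / 4]. Independence turns
    the moment generating function into a power of that of a single draw, which
    is at most [expR ((l + 2 l^2) m)] where [m] is the mass of [A]; the exponents
    then differ by [n t^2 (1 - m) / 8], which is nonnegative. The sum over words
    is the probability of the event when the letters are drawn from [P]. *)
Lemma chernoff_upper P A n (t : R) : prob_vector P -> 0 < t -> t <= 2 ->
  \sum_(s : {ffun 'I_n -> C} | mass P A + t < freq s A) \prod_i P (s i)
  <= expR (- (n%:R * (t ^+ 2 / 8))).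
Proof.
move=> pP t0 t2; have [P0 P1] := pP.
pose l := t / 4; set m := mass P A.
have l0 : 0 <= l by rewrite divr_ge0// ltW.
have m0 : 0 <= m by exact: mass_ge0.
have m1 : m <= 1 by exact: mass_le1.
pose w a : R := expR (l * (a \in A)%:R).
pose K := expR (- (l * (n%:R * (m + t)))).
have step1 : \sum_(s : {ffun 'I_n -> C} | m + t < freq s A) \prod_i P (s i)
    <= \sum_(s : {ffun 'I_n -> C}) K * \prod_i (P (s i) * w (s i)).
  rewrite big_mkcond/=; apply: ler_sum => s _.
  have Ps0 : 0 <= \prod_i P (s i) by exact: prodr_ge0.
  case: ifPn => [dev|_]; last first.
    by rewrite mulr_ge0 ?expR_ge0// prodr_ge0// => i _; rewrite mulr_ge0 ?expR_ge0.
  rewrite big_split/= mulrCA ler_peMr// /K /w -expR_sum -expRD.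
  rewrite -[leLHS]expR0 ler_expR -mulr_sumr addrC -mulrBr mulr_ge0// subr_ge0.
  move: dev; rewrite /freq; case: n s {Ps0 K} => [|n] s dev.
    by rewrite mul0r big_ord0.
  by rewrite mulrC -ler_pdivlMr// ltW.
apply: le_trans step1 _; rewrite -mulr_sumr.
rewrite -(bigA_distr_bigA (fun (_ : 'I_n) a => P a * w a))/= prodr_const card_ord.
have mgf : \sum_a P a * w a <= expR ((l + 2 * l ^+ 2) * m).
  apply: le_trans (expR_ge1Dx _).
  rewrite -[X in X + _]P1 /m /mass [X in _ * X]big_mkcond/= mulr_sumr -big_split/=.
  apply: ler_sum => a _; rewrite /w; case: ifPn => aA; rewrite ?mulr1 ?mulr0 ?addr0.
    rewrite -[X in X + _]mulr1 [X in _ + X]mulrC -mulrDr ler_wpM2l//.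
    by rewrite addrA expR_le_quadratic// /l; lra.
  by rewrite expR0 mulr1.
have mgf0 : 0 <= \sum_a P a * w a.
  by apply: sumr_ge0 => a _; rewrite mulr_ge0 ?expR_ge0.
apply: (@le_trans _ _ (K * expR ((l + 2 * l ^+ 2) * m) ^+ n)).
  by rewrite ler_wpM2l ?expR_ge0// lerXn2r ?nnegrE ?expR_ge0.
rewrite /K -expRM_natl -expRD ler_expR.
rewrite -subr_ge0.
rewrite (_ : _ - _ = n%:R * (t ^+ 2 / 8 * (1 - m))); last by rewrite /l; field.
by apply: mulr_ge0 => //; rewrite mulr_ge0 ?subr_ge0// divr_ge0 ?sqr_ge0.
Qed.

(** The lower tail of [A] is the upper tail of its complement. *)
Lemma chernoff P A n (t : R) : (0 < n)%N -> prob_vector P -> 0 < t -> t <= 2 ->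
  \sum_(s : {ffun 'I_n -> C} | t < `|freq s A - mass P A|) \prod_i P (s i)
  <= 2 * expR (- (n%:R * (t ^+ 2 / 8))).
Proof.
move=> n0 pP t0 t2; have [P0 P1] := pP.
have := lerD (chernoff_upper A n pP t0 t2) (chernoff_upper (~: A) n pP t0 t2).
rewrite -mulr2n -[leRHS]mulr_natl => h; apply: le_trans h.
rewrite big_mkcond/= [X in _ <= X + _]big_mkcond/= [X in _ <= _ + X]big_mkcond/=.
rewrite -big_split/=; apply: ler_sum => s _.
have F0 : 0 <= \prod_i P (s i) by exact: prodr_ge0.
rewrite freq_setC// mass_setC//.
case: ifPn => [|_]; last first.
  by rewrite addr_ge0//; case: ifP.
case: (lerP 0 (freq s A - mass P A)) => h; [rewrite ger0_norm//|rewrite ltr0_norm//] => th.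
  rewrite ifT; first by rewrite lerDl; case: ifP.
  by move: th; rewrite ltrBrDl addrC.
rewrite [X in _ + X]ifT; first by rewrite lerDr; case: ifP.
move: th; lra.
Qed.

End EmpiricalFrequency.

(** * Minimum distance estimation over a finite family *)

Section MinimumDistance.
Context {R : realType} {C Theta : finType}.
Implicit Types P Q : C -> R.

Lemma l1_prob_vector P Q : prob_vector P -> prob_vector Q ->
  \sum_a `|P a - Q a| =
  2 * (mass P [set a | Q a < P a] - mass Q [set a | Q a < P a]).
Proof.
move=> [_ P1] [_ Q1].
have PQ0 : \sum_a (P a - Q a) = 0 by rewrite sumrB P1 Q1 subrr.
rewrite /mass -sumrB -[LHS]addr0 -[X in _ + X]PQ0 -big_split/=.
rewrite [X in _ * X]big_mkcond/= mulr_sumr; apply: eq_bigr => a _; rewrite inE.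
by case: ltP => h; [rewrite gtr0_norm ?subr_gt0//|rewrite ler0_norm ?subr_le0//]; ring.
Qed.

(** The mass differences on [A] and on its complement are opposite, hence the
    factor 2; without it the oracle inequality would have constant 5 instead of
    3. *)
Lemma mass_dist_le P Q A : prob_vector P -> prob_vector Q ->
  2 * `|mass P A - mass Q A| <= \sum_a `|P a - Q a|.
Proof.
move=> pP pQ.
have -> : 2 * `|mass P A - mass Q A| =
    `|mass P A - mass Q A| + `|mass P (~: A) - mass Q (~: A)|.
  rewrite !mass_setC// (_ : _ - (1 - _) = - (mass P A - mass Q A)); last by ring.
  by rewrite normrN; ring.
rewrite (bigID (mem A))/=; apply: lerD; rewrite /mass -sumrB.
  exact: ler_norm_sum.
rewrite [X in `|X| <= _](eq_bigl (fun a => a \notin A)); last by move=> a; rewrite inE.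
exact: ler_norm_sum.
Qed.

Variables (c : Theta -> C -> R) (t0 : Theta).

(** The Yatracos sets: comparing masses on them alone determines every [L1]
    distance between members of the family. *)
Definition yatracos (tu : Theta * Theta) : {set C} :=
  [set a | c tu.2 a < c tu.1 a].

Definition discrepancy n (s : {ffun 'I_n -> C}) t : R :=
  \big[Num.max/0]_tu `|mass (c t) (yatracos tu) - freq s (yatracos tu)|.

(** The minimum distance rule: the member of the family whose masses on the
    Yatracos sets are the closest to the empirical frequencies. *)
Definition min_distance n (s : {ffun 'I_n -> C}) : Theta :=
  [arg min_(t < t0) discrepancy s t]%O.

Definition max_deviation P n (s : {ffun 'I_n -> C}) : R :=
  \big[Num.max/0]_tu `|freq s (yatracos tu) - mass P (yatracos tu)|.

Hypothesis c_prob : forall t, prob_vector (c t).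

(** The [L1] distance of two members is twice their mass difference on the set
    where the first is larger, which is one of the sets entering
    [discrepancy]; so it is at most twice the sum of their discrepancies, and
    minimality replaces the estimator's discrepancy by that of [u]. *)
Lemma min_distance_oracle P n (s : {ffun 'I_n -> C}) u : prob_vector P ->
  \sum_a `|c (min_distance s) a - c u a|
  <= 2 * (\sum_a `|c u a - P a|) + 4 * max_deviation P s.
Proof.
move=> pP; set m := min_distance s; set D := max_deviation P s.
have dm : discrepancy s m <= discrepancy s u.
  by rewrite /m /min_distance; case: arg_minP => // i _; apply.
have du : discrepancy s u <= 2^-1 * (\sum_a `|c u a - P a|) + D.
  apply: bigmax_le => [|tu _].
    rewrite addr_ge0 ?mulr_ge0 ?sumr_ge0//.
    exact: bigmax_ge_id.
  have dev : `|freq s (yatracos tu) - mass P (yatracos tu)| <= D.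
    exact: (le_bigmax 0 (fun tu => `|freq s (yatracos tu) - mass P (yatracos tu)|)).
  have := mass_dist_le (yatracos tu) (c_prob u) pP.
  have := ler_distD (mass P (yatracos tu)) (mass (c u) (yatracos tu))
    (freq s (yatracos tu)).
  rewrite (distrC (mass P _)); move: dev; lra.
have le_disc t : `|mass (c t) (yatracos (m, u)) - freq s (yatracos (m, u))|
    <= discrepancy s t.
  exact: (le_bigmax 0 (fun tu => `|mass (c t) (yatracos tu) - freq s (yatracos tu)|)).
rewrite l1_prob_vector// -/(yatracos (m, u)).
have := ler_distD (freq s (yatracos (m, u))) (mass (c m) (yatracos (m, u)))
  (mass (c u) (yatracos (m, u))).
have := ler_norm (mass (c m) (yatracos (m, u)) - mass (c u) (yatracos (m, u))).
rewrite (distrC (freq s _) (mass (c u) _)).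
have := le_disc m; have := le_disc u; lra.
Qed.

(** Union bound over the pairs of members. The size of the family enters as a
    factor in front of an exponential in [n], so a family whose logarithmic size
    is [o(n)] is harmless. *)
Lemma max_deviation_tail P n (t : R) : (0 < n)%N -> prob_vector P ->
  0 < t -> t <= 2 ->
  \sum_(s : {ffun 'I_n -> C} | t < max_deviation P s) \prod_i P (s i)
  <= (#|Theta| ^ 2)%:R * (2 * expR (- (n%:R * (t ^+ 2 / 8)))).
Proof.
move=> n0 pP tgt0 t2; have [P0 _] := pP.
pose dev tu (s : {ffun 'I_n -> C}) :=
  t < `|freq s (yatracos tu) - mass P (yatracos tu)|.
apply: (@le_trans _ _ (\sum_tu \sum_(s | dev tu s) \prod_i P (s i))).
  under [leRHS]eq_bigr do rewrite big_mkcond.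
  rewrite exchange_big/= big_mkcond/=; apply: ler_sum => s _.
  have F0 : 0 <= \prod_i P (s i) by exact: prodr_ge0.
  have S0 (Q : pred (Theta * Theta)) : 0 <= \sum_tu if Q tu then \prod_i P (s i) else 0.
    by apply: sumr_ge0 => tu _; case: ifP.
  case: ifPn => [/bigmax_gtP[|[tu _ dtu]]|_]; last exact: (S0 (dev^~ s)).
    by rewrite ltNge ltW.
  rewrite (bigD1 tu)//= {1}/dev dtu lerDl.
  by apply: sumr_ge0 => tv _; case: ifP.
apply: (@le_trans _ _ (\sum_(tu : Theta * Theta) 2 * expR (- (n%:R * (t ^+ 2 / 8))))).
  by apply: ler_sum => tu _; exact: chernoff.
by rewrite sumr_const card_prod -[leLHS]mulr_natl expnS expn1.
Qed.

End MinimumDistance.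

(** * Mixtures of products of probability vectors and their nets *)

Section MixtureCoefficients.
Variables (R : realType) (d b k : nat).

Definition cell := {ffun 'I_d -> 'I_b}.

Definition index := ('I_k + 'I_k * 'I_d * 'I_b)%type.

(** The weights sit at the indices [inl i], the bin probabilities of the
    [j]-th factor of the [i]-th component at [inr (i, j, l)]. A flat family of
    reals makes the parameter space a power of [R], to which Tychonoff's theorem
    applies. *)
Definition params := index -> R.

Definition valid (theta : params) :=
  prob_vector (fun i => theta (inl i)) /\
  forall i j, prob_vector (fun l => theta (inr (i, j, l))).

(** The probability that the mixture assigns to the cell [a]. *)
Definition coef (theta : params) (a : cell) : R :=
  \sum_i theta (inl i) * \prod_j theta (inr (i, j, a j)).

Lemma coef_prob theta : valid theta -> prob_vector (coef theta).
Proof.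
move=> [[w0 w1] ha]; split=> [a|].
  apply: sumr_ge0 => i _; rewrite mulr_ge0// prodr_ge0// => j _.
  by have [] := ha i j.
rewrite exchange_big/= -[RHS]w1; apply: eq_bigr => i _.
rewrite -mulr_sumr -(bigA_distr_bigA (fun j l => theta (inr (i, j, l))))/=.
by rewrite big1 ?mulr1// => j _; have [] := ha i j.
Qed.

(** Telescoping: the [j]-th term replaces the [j]-th factor, with those of [y]
    before it and those of [x] after it. Each bound is again a product over the
    coordinates, so that it can be summed coordinate by coordinate. *)
Lemma dist_prod_le m (x y : 'I_m -> R) :
  (forall i, 0 <= x i) -> (forall i, 0 <= y i) ->
  `|\prod_i x i - \prod_i y i| <=
  \sum_(j < m) \prod_(i < m) (if (i < j)%N then y i else if i == j then `|x i - y i| else x i).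
Proof.
elim: m x y => [|m IHm] x y x0 y0; first by rewrite !big_ord0 subrr normr0.
rewrite !big_ord_recl/=.
under [X in _ <= _ + X]eq_bigr do rewrite big_ord_recl/=.
set X := \prod_(i < m) x _; set Y := \prod_(i < m) y _.
have -> : x ord0 * X - y ord0 * Y = (x ord0 - y ord0) * X + y ord0 * (X - Y) by ring.
rewrite (le_trans (ler_normD _ _))// !normrM; apply: lerD.
  by rewrite ler_wpM2l// ger0_norm//; exact: prodr_ge0.
rewrite -mulr_sumr ger0_norm// ler_wpM2l//.
by apply: le_trans (IHm (x \o lift ord0) (y \o lift ord0) _ _) _ => //=.
Qed.

Lemma l1_prod_le (x y : 'I_d -> 'I_b -> R) :
  (forall j, prob_vector (x j)) -> (forall j, prob_vector (y j)) ->
  \sum_(a : cell) `|\prod_j x j (a j) - \prod_j y j (a j)| <=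
  \sum_j \sum_l `|x j l - y j l|.
Proof.
move=> px py.
have x0 j l : 0 <= x j l by have [] := px j.
have y0 j l : 0 <= y j l by have [] := py j.
pose z (j i : 'I_d) l := if (i < j)%N then y i l else
  if i == j then `|x i l - y i l| else x i l.
apply: (@le_trans _ _ (\sum_(a : cell) \sum_j \prod_i z j i (a i))).
  apply: ler_sum => a _.
  exact: (dist_prod_le (x := fun j => x j (a j)) (y := fun j => y j (a j))).
rewrite exchange_big/=; apply: ler_sum => j _.
rewrite -(bigA_distr_bigA (z j)) (bigD1 j)//= [X in _ * X]big1 ?mulr1 => [|i ij].
  by apply: ler_sum => l _; rewrite /z ltnn eqxx.
rewrite /z (negbTE ij); case: ltnP => _; first by have [] := py i.
by have [] := px i.
Qed.

Lemma l1_coef_le theta theta' : valid theta -> valid theta' ->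
  \sum_a `|coef theta a - coef theta' a| <=
  \sum_i `|theta (inl i) - theta' (inl i)| +
  \sum_i theta' (inl i) *
    \sum_j \sum_l `|theta (inr (i, j, l)) - theta' (inr (i, j, l))|.
Proof.
move=> [pw pa] [pw' pa'].
pose W (th : params) (i : 'I_k) (a : cell) : R := \prod_j th (inr (i, j, a j)) : R.
pose D i a : R := `|W theta i a - W theta' i a|.
have W0 i a : 0 <= W theta i a.
  by apply: prodr_ge0 => j _; have [] := pa i j.
have W1 i : \sum_a W theta i a = 1.
  rewrite -(bigA_distr_bigA (fun j l => theta (inr (i, j, l))))/= big1// => j _.
  by have [] := pa i j.
apply: (@le_trans _ _ (\sum_a \sum_i
    (`|theta (inl i) - theta' (inl i)| * W theta i a + theta' (inl i) * D i a))).
  apply: ler_sum => a _; rewrite /coef -sumrB (le_trans (ler_norm_sum _ _ _))//.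
  apply: ler_sum => i _; rewrite -/(W theta i a) -/(W theta' i a).
  rewrite [X in `|X|](_ : _ = (theta (inl i) - theta' (inl i)) * W theta i a
    + theta' (inl i) * (W theta i a - W theta' i a)); last by ring.
  rewrite (le_trans (ler_normD _ _))// !normrM (ger0_norm (W0 _ _)).
  by rewrite (ger0_norm (pw'.1 i)).
rewrite exchange_big/= -big_split/=; apply: ler_sum => i _.
rewrite big_split/= -!mulr_sumr W1 mulr1 lerD2l ler_wpM2l ?pw'.1//.
exact: (l1_prod_le (pa i) (pa' i)).
Qed.

Hypotheses (b_gt0 : (0 < b)%N) (k_gt0 : (0 < k)%N).

Lemma prob_vector_uniform m : (0 < m)%N ->
  prob_vector (fun _ : 'I_m => m%:R^-1 : R).
Proof.
move=> m0; split=> [_|]; first by rewrite invr_ge0.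
by rewrite sumr_const card_ord -[LHS]mulr_natl divff// pnatr_eq0 -lt0n.
Qed.

Lemma valid_exists : exists theta, valid theta.
Proof.
exists (fun u => match u with inl _ => k%:R^-1 | inr _ => b%:R^-1 end).
by split => [|i j]; exact: prob_vector_uniform.
Qed.

Lemma prob_vector_le1 (I : finType) (P : I -> R) i : prob_vector P -> P i <= 1.
Proof.
by move=> [P0 <-]; rewrite (bigD1 i)//= lerDl sumr_ge0.
Qed.

Lemma dist_le_truncn m (x y : R) : (0 < m)%N -> 0 <= x <= 1 -> 0 <= y <= 1 ->
  inord (Num.truncn (m%:R * x)) = inord (Num.truncn (m%:R * y)) :> 'I_m.+1 ->
  `|x - y| <= m%:R^-1.
Proof.
move=> m0 /andP[x0 x1] /andP[y0 y1].
have lem z : 0 <= z -> z <= 1 -> (Num.truncn (m%:R * z) < m.+1)%N.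
  move=> z0 z1; rewrite truncn_lt_nat ?mulr_ge0//.
  by rewrite (le_lt_trans (ler_piMr _ z1))// ltr_nat.
move=> /(congr1 (@nat_of_ord _)); rewrite !inordK ?lem// => e.
have mp : 0 < m%:R :> R by rewrite ltr0n.
have /andP[] := truncn_itv (mulr_ge0 (ltW mp) x0).
have /andP[] := truncn_itv (mulr_ge0 (ltW mp) y0).
rewrite e -!natr1 => h1 h2 h3 h4.
rewrite -(ler_pM2l mp) divff ?gt_eqF// -{1}(ger0_norm (ltW mp)) -normrM mulrBr.
rewrite ler_norml; lra.
Qed.

(** Rounding at resolutions [k ^ -2] and [b ^ -2]: the [L1] errors, [1 / k] on the
    weights and [d / b] on the factors, vanish as [b] and [k] grow, while the
    logarithm of the number of codes stays of order [k log k + b k log b]. *)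
Definition code : finType :=
  ({ffun 'I_k -> 'I_(k ^ 2).+1} * {ffun 'I_k * 'I_d * 'I_b -> 'I_(b ^ 2).+1})%type.

Definition encode (theta : params) : code :=
  ([ffun i => inord (Num.truncn ((k ^ 2)%:R * theta (inl i)))],
   [ffun u => inord (Num.truncn ((b ^ 2)%:R * theta (inr u)))]).

Lemma card_code : #|code| = ((k ^ 2).+1 ^ k * (b ^ 2).+1 ^ (k * d * b))%N.
Proof. by rewrite card_prod !card_ffun !card_prod !card_ord. Qed.

Lemma l1_coef_encode theta theta' : valid theta -> valid theta' ->
  encode theta = encode theta' ->
  \sum_a `|coef theta a - coef theta' a| <= k%:R^-1 + d%:R / b%:R.
Proof.
move=> v v' [/ffunP ew /ffunP ea]; have [pw pa] := v; have [pw' pa'] := v'.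
have kN0 : k%:R != 0 :> R by rewrite pnatr_eq0 -lt0n.
have bN0 : b%:R != 0 :> R by rewrite pnatr_eq0 -lt0n.
have itv (I : finType) (P : I -> R) i : prob_vector P -> 0 <= P i <= 1.
  by move=> pP; rewrite prob_vector_le1// pP.1.
have dw i : `|theta (inl i) - theta' (inl i)| <= (k ^ 2)%:R^-1.
  apply: dist_le_truncn; rewrite ?expn_gt0 ?k_gt0 ?(itv _ _ _ pw) ?(itv _ _ _ pw')//.
  by have := ew i; rewrite !ffunE.
have da i j l : `|theta (inr (i, j, l)) - theta' (inr (i, j, l))| <= (b ^ 2)%:R^-1.
  apply: dist_le_truncn; rewrite ?expn_gt0 ?b_gt0 ?(itv _ _ _ (pa i j)) ?(itv _ _ _ (pa' i j))//.
  by have := ea (i, j, l); rewrite !ffunE.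
apply: le_trans (l1_coef_le v v') _; apply: lerD.
  apply: le_trans (ler_sum _ (fun i _ => dw i)) _.
  by rewrite sumr_const card_ord -[leLHS]mulr_natl natrX invfM mulrA divff// mul1r.
apply: (@le_trans _ _ (\sum_i theta' (inl i) * (d%:R / b%:R))); last first.
  by rewrite -mulr_suml pw'.2 mul1r.
apply: ler_sum => i _; rewrite ler_wpM2l ?pw'.1//.
apply: le_trans (ler_sum _ (fun j _ => ler_sum _ (fun l _ => da i j l))) _.
rewrite !sumr_const !card_ord -[leLHS]mulr_natl -[X in _ * X]mulr_natl natrX invfM.
by rewrite [b%:R * _]mulrA divff// mul1r.
Qed.

(** Choosing one mixture per occupied code spares the projection of rounded
    vectors back to the simplices. *)
Lemma net_exists : exists rep : code -> params,
  (forall t, valid (rep t)) /\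
  forall theta, valid theta -> exists t,
    \sum_a `|coef (rep t) a - coef theta a| <= k%:R^-1 + d%:R / b%:R.
Proof.
have /choice[rep repP] : forall t, exists theta, valid theta /\
    ((exists2 theta', valid theta' & encode theta' = t) -> encode theta = t).
  move=> t; have [[theta v e]|nex] := pselect (exists2 theta, valid theta & encode theta = t).
    by exists theta.
  by have [theta v] := valid_exists; exists theta; split.
exists rep; split=> [t|theta v]; first by have [] := repP t.
exists (encode theta); have [vr er] := repP (encode theta).
by apply: l1_coef_encode => //; apply: er; exists theta.
Qed.

End MixtureCoefficients.

(** * Piecewise constant functions on the cells of the unit cube *)

Section CellPartition.
Variables (R : realType) (d b : nat).
Hypothesis b_gt0 : (0 < b)%N.
Local Notation T := (d.-tuple (measurableTypeR R)).
Local Notation mu := (@lebesgue R d).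
Local Notation cube := (@cube R d).
Local Notation cell := (cell d b).

(** The bin as a set rather than as a density; the cells below are products of
    these. *)
Definition bin (l : 'I_b) : set R := `[l%:R / b%:R, l.+1%:R / b%:R[%classic.

Let bp : 0 < b%:R :> R. Proof. by rewrite ltr0n. Qed.

Lemma binP l x : bin l x <-> 0 <= x /\ Num.truncn (b%:R * x) = l :> nat.
Proof.
rewrite /bin/= in_itv/= ler_pdivrMr// ltr_pdivlMr// mulrC; split.
  move=> h; have : 0 <= b%:R * x by case/andP: h => h _; exact: le_trans h.
  by rewrite pmulr_rge0// => x0; rewrite (truncn_def h).
by move=> [x0 <-]; rewrite truncn_itv// mulr_ge0// ltW.
Qed.

Lemma bin_inj l l' x : bin l x -> bin l' x -> l = l'.
Proof. by move=> /binP[_ e] /binP[_ e']; apply: val_inj; rewrite /= -e -e'. Qed.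

Lemma bin_unit l x : bin l x -> 0 <= x < 1.
Proof.
move=> /[dup] /binP[-> _]; rewrite /bin/= in_itv/= => /andP[_ xl].
rewrite (lt_le_trans xl)// ler_pdivrMr// mul1r ler_nat; exact: ltn_ord.
Qed.

Lemma bin_cover x : 0 <= x < 1 -> exists l, bin l x.
Proof.
move=> /andP[x0 x1]; have lb : (Num.truncn (b%:R * x) < b)%N.
  by rewrite truncn_lt_nat ?mulr_ge0// gtr_pMr.
by exists (Ordinal lb); apply/binP.
Qed.

Lemma lebesgue_measure_bin l : lebesgue_measure (bin l) = (b%:R^-1)%:E.
Proof.
rewrite lebesgue_measure_itv/= lte_fin ltr_pM2r ?invr_gt0// ltr_nat ltnSn.
by rewrite -EFinB -mulrBl -natr1 addrAC subrr add0r mul1r.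
Qed.

Definition box (a : cell) : set T := [set x | forall j, bin (a j) (tnth x j)].

Lemma measurable_cell_box a : measurable (box a).
Proof.
apply: (@measurable_box _ (measurableTypeR R) d (fun j => bin (a j))) => j.
exact: measurable_itv.
Qed.

Lemma lebesgue_box a : mu (box a) = (b%:R ^- d)%:E.
Proof.
have := @power_measure_box _ (measurableTypeR R) R (@lebesgue_measure R) d
  (fun j => bin (a j)) (fun j => measurable_itv _).
rewrite /lebesgue /box => ->.
rewrite (eq_bigr (fun=> (b%:R^-1)%:E)) => [|j _]; last exact: lebesgue_measure_bin.
by rewrite prodEFin prodr_const card_ord exprVn.
Qed.

Lemma box_cube a : box a `<=` cube.
Proof. by move=> x ax j; exact: bin_unit (ax j). Qed.

Lemma box_inj a a' x : box a x -> box a' x -> a = a'.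
Proof. by move=> ax ax'; apply/ffunP => j; exact: bin_inj (ax j) (ax' j). Qed.

Lemma trivIset_box (D : set cell) : trivIset D box.
Proof. by move=> a a' _ _ [x [ax ax']]; exact: box_inj ax ax'. Qed.

Lemma box_cover x : cube x -> exists a, box a x.
Proof.
move=> cx; have /choice[f fP] : forall j, exists l, bin l (tnth x j).
  by move=> j; exact: bin_cover.
by exists [ffun j => f j] => j; rewrite ffunE.
Qed.

Lemma cube_bigsetU : cube = \big[setU/set0]_(a : cell) box a.
Proof.
apply/seteqP; split => x.
  by move=> /box_cover[a ax]; rewrite (bigD1 a)//=; left.
by rewrite -bigcup_seq => -[a _]; exact: box_cube.
Qed.

Definition cell_density (a : cell) (x : T) : R :=
  \prod_j bin_density (R := R) (a j) (tnth x j).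

Lemma cell_densityE a x : cell_density a x = b%:R ^+ d * \1_(box a) x.
Proof.
rewrite /cell_density big_split/= prodr_const card_ord; congr (_ * _).
rewrite indicE; have [ax|nax] := pselect (box a x).
  by rewrite mem_set// big1// => j _; rewrite indicE mem_set//; exact: ax.
rewrite memNset//; have [j nj] : exists j, ~ bin (a j) (tnth x j).
  by apply/existsNP.
by rewrite (bigD1 j)//= indicE memNset// mul0r.
Qed.

Lemma cell_density_ge0 a x : 0 <= cell_density a x.
Proof. by rewrite cell_densityE mulr_ge0// exprn_ge0// ltW. Qed.

Lemma measurable_cell_density a D : measurable_fun D (cell_density a).
Proof.
rewrite (_ : cell_density a = (fun x => b%:R ^+ d * \1_(box a) x)).
  by apply: measurable_funM => //; apply: measurable_indic; exact: measurable_cell_box.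
by apply/funext => x; rewrite cell_densityE.
Qed.

Lemma integral_cell_density a : (\int[mu]_(x in cube) (cell_density a x)%:E = 1)%E.
Proof.
have mc : measurable cube by exact: measurable_cube.
have mb := measurable_cell_box a.
under eq_integral do rewrite cell_densityE EFinM.
rewrite ge0_integralZl//=.
  rewrite integral_indic// setIidl; last exact: box_cube.
  rewrite [X in (_ * X)%E](lebesgue_box a).
  by rewrite -EFinM divff// expf_neq0// gt_eqF.
by apply/measurable_EFinP; exact: measurable_indic.
Qed.

Definition hist (c : cell -> R) (x : T) : R := \sum_a c a * cell_density a x.

Lemma measurable_hist c D : measurable_fun D (hist c).
Proof.
apply: measurable_sum => a; apply: measurable_funM => //.
exact: measurable_cell_density.
Qed.

Lemma hist_box c a x : box a x -> hist c x = c a * b%:R ^+ d.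
Proof.
move=> ax; rewrite /hist (bigD1 a)//= big1 => [|a' aa'].
  by rewrite addr0 cell_densityE indicE mem_set// mulr1.
rewrite cell_densityE indicE memNset ?mulr0//.
by move=> ax'; case/eqP: aa'; exact: box_inj ax' ax.
Qed.

Lemma L1_dist_ge0 (f g : T -> R) : (0 <= L1_dist f g)%E.
Proof. by apply: integral_ge0 => x _; rewrite lee_fin. Qed.

Lemma L1_distC (f g : T -> R) : L1_dist f g = L1_dist g f.
Proof. by apply: eq_integral => x _; rewrite distrC. Qed.

Lemma measurable_abs_sub (f g : T -> R) D : measurable_fun D f ->
  measurable_fun D g -> measurable_fun D (fun x => `|f x - g x|%:E).
Proof.
move=> mf mg; apply/measurable_EFinP; apply: measurableT_comp => //.
exact: measurable_funB.
Qed.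

Lemma L1_dist_triangle (f g h : T -> R) : measurable_fun cube f ->
  measurable_fun cube g -> measurable_fun cube h ->
  (L1_dist f h <= L1_dist f g + L1_dist g h)%E.
Proof.
move=> mf mg mh; rewrite /L1_dist -ge0_integralD//=; first last.
- exact: measurable_abs_sub.
- exact: measurable_abs_sub.
- exact: measurable_cube.
apply: ge0_le_integral => //=.
- exact: measurable_cube.
- exact: measurable_abs_sub.
- by apply: emeasurable_funD; exact: measurable_abs_sub.
- by move=> x _; rewrite -EFinD lee_fin ler_distD.
Qed.

(** Each cell density has integral one, so [hist] is a contraction from the [l1]
    norm of the coefficients to the [L1] norm. *)
Lemma L1_dist_hist_le c c' :
  (L1_dist (hist c) (hist c') <= (\sum_a `|c a - c' a|)%:E)%E.
Proof.
apply: (@le_trans _ _ (\int[mu]_(x in cube)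
    \sum_a (`|c a - c' a|%:E * (cell_density a x)%:E))%E).
  apply: ge0_le_integral => //=.
  - exact: measurable_cube.
  - by apply: measurable_abs_sub; exact: measurable_hist.
  - apply: emeasurable_sum => a; apply: emeasurable_funM => //.
    by apply/measurable_EFinP; exact: measurable_cell_density.
  - move=> x _; under eq_bigr do rewrite -EFinM.
    rewrite sumEFin lee_fin /hist -sumrB (le_trans (ler_norm_sum _ _ _))//.
    apply: ler_sum => a _.
    by rewrite -mulrBl normrM (ger0_norm (cell_density_ge0 _ _)).
rewrite ge0_integral_sum//=; last 3 first.
- exact: measurable_cube.
- move=> a; apply: emeasurable_funM => //.
  by apply/measurable_EFinP; exact: measurable_cell_density.
- by move=> a x _; rewrite -EFinM lee_fin mulr_ge0// cell_density_ge0.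
rewrite -sumEFin; apply: lee_sum => a _.
rewrite ge0_integralZl//=.
- by rewrite integral_cell_density mule1.
- exact: measurable_cube.
- by apply/measurable_EFinP; exact: measurable_cell_density.
- by move=> x _; rewrite lee_fin cell_density_ge0.
Qed.

Section density.
Variable p : density (R := R) d.

(** The discretization of [p]: all that the sample reveals once its points are
    replaced by their cells. *)
Definition cell_mass (a : cell) : R := fine (law p (box a)).

Lemma cell_massE a : (cell_mass a)%:E = law p (box a).
Proof.
rewrite fineK// ge0_fin_numE; last exact: measure_ge0.
rewrite (@le_lt_trans _ _ 1%E) ?ltry//.
by apply: probability_le1; exact: measurable_cell_box.
Qed.

Lemma cell_mass_prob : prob_vector cell_mass.
Proof.
split=> [a|]; first by rewrite fine_ge0// measure_ge0.
apply: EFin_inj; rewrite -sumEFin -[RHS](integral_pdf p) cube_bigsetU.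
rewrite ge0_integral_bigsetU//=.
- by apply: eq_bigr => a _; rewrite cell_massE /law setIidl//; exact: box_cube.
- exact: measurable_cell_box.
- exact: index_enum_uniq.
- exact: trivIset_box.
- by rewrite -cube_bigsetU; apply/measurable_EFinP; exact: measurable_pdf.
- by rewrite -cube_bigsetU => x cx; rewrite lee_fin pdf_ge0.
Qed.

(** Integrating over cells contracts the [L1] distance: on each cell, [c a] and
    the mass of [p] are integrals of the two functions being compared. *)
Lemma l1_cell_mass_le c : (forall a, 0 <= c a) ->
  ((\sum_a `|c a - cell_mass a|)%:E <= L1_dist (hist c) p)%E.
Proof.
move=> c0; rewrite /L1_dist {1}cube_bigsetU.
have mp a : measurable_fun (box a) p.
  apply: measurable_funS (measurable_pdf p); first exact: measurable_cube.
  exact: box_cube.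
rewrite ge0_integral_bigsetU//=; first last.
- rewrite -cube_bigsetU; apply: measurable_abs_sub; first exact: measurable_hist.
  exact: measurable_pdf.
- exact: trivIset_box.
- exact: index_enum_uniq.
- exact: measurable_cell_box.
rewrite -sumEFin; apply: lee_sum => a _.
have mb := measurable_cell_box a.
have ch : (\int[mu]_(x in box a) (hist c x)%:E = (c a)%:E)%E.
  under eq_integral => x do [rewrite inE => ax; rewrite (hist_box _ ax)].
  rewrite integral_cst// [X in (_ * X)%E](lebesgue_box a) -EFinM -mulrA divff ?mulr1//.
  by rewrite expf_neq0// gt_eqF.
have cp : (\int[mu]_(x in box a) (p x)%:E = (cell_mass a)%:E)%E.
  by rewrite cell_massE /law setIidl//; exact: box_cube.
have h0 x : box a x -> 0 <= hist c x.
  by move=> ax; rewrite (hist_box _ ax) mulr_ge0// exprn_ge0// ltW.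
have p0 x : box a x -> 0 <= p x by move=> /box_cube; exact: pdf_ge0.
have mh : measurable_fun (box a) (hist c) by exact: measurable_hist.
set I := (\int[mu]_(x in _) _)%E.
have le_int (f g : T -> R) : (forall x, box a x -> 0 <= f x) ->
    (forall x, box a x -> 0 <= g x) -> measurable_fun (box a) f ->
    measurable_fun (box a) g ->
    (\int[mu]_(x in box a) (f x)%:E <= \int[mu]_(x in box a) (g x)%:E +
      \int[mu]_(x in box a) `|f x - g x|%:E)%E.
  move=> f0 g0 mf mg; rewrite -ge0_integralD//=; last 2 first.
  - exact/measurable_EFinP.
  - exact: measurable_abs_sub.
  apply: ge0_le_integral => //=.
  - exact/measurable_EFinP.
  - by apply: emeasurable_funD; [exact/measurable_EFinP|exact: measurable_abs_sub].
  - move=> x ax; rewrite -EFinD lee_fin -lerBlDl; exact: ler_norm.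
have h1 := le_int _ _ h0 p0 mh (mp a).
have h2 := le_int _ _ p0 h0 (mp a) mh.
rewrite ch cp -/I in h1.
have eI : (\int[mu]_(x in box a) `|p x - hist c x|%:E = I)%E.
  by apply: eq_integral => x _; rewrite distrC.
rewrite ch cp eI in h2.
move: h1 h2; clear eI; case: I => [r| |]; rewrite ?leey// -?EFinD !lee_fin => h1 h2.
by rewrite ler_norml; apply/andP; split; lra.
Qed.

End density.
End CellPartition.

(** * Coordinates on multi-view histograms *)

Section Representation.
Variables (R : realType) (d b k : nat).
Local Notation T := (d.-tuple (measurableTypeR R)).

(** A convex combination may repeat the same bin; grouping the weights by bin
    yields one weight per bin. *)
Lemma histogram1P (f : R -> R) : histogram1 b f <->
  exists2 h : 'I_b -> R, prob_vector h & f = fun x => \sum_l h l * bin_density l x.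
Proof.
split=> [[m [w [g [[w0 w1] gS fE]]]]|[h h_prob ->]]; last first.
  by exists b, h, (@bin_density R b); split => // l; exists l.
have /choice[l lE] : forall i, exists l : 'I_b, bin_density l = g i.
  by move=> i; have [l _ <-] := gS i; exists l.
exists (fun l' => \sum_(i | l i == l') w i).
  split=> [l'|]; first by rewrite sumr_ge0.
  by rewrite -[RHS]w1 [RHS](partition_big l xpredT).
rewrite fE; apply/funext => x; rewrite (partition_big l xpredT)//=.
apply: eq_bigr => l' _; rewrite mulr_suml; apply: eq_bigr => i /eqP <-.
by rewrite lE.
Qed.

(** Distributing the product over the coordinates over the sums over the bins
    produces exactly one term per cell. *)
Lemma hist_coef (theta : params R d b k) (x : T) : hist (coef theta) x =
  \sum_i theta (inl i) * \prod_j \sum_l theta (inr (i, j, l)) * bin_density l (tnth x j).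
Proof.
under [RHS]eq_bigr => i _ do
  rewrite (bigA_distr_bigA (fun j l => theta (inr (i, j, l)) * bin_density l (tnth x j))) mulr_sumr.
rewrite exchange_big/=; apply: eq_bigr => a _.
rewrite mulr_suml; apply: eq_bigr => i _.
by rewrite big_split/= mulrA.
Qed.

Lemma multiview_histogramP (q : T -> R) : multiview_histogram d b k q <->
  exists2 theta : params R d b k, valid theta & q = hist (coef theta).
Proof.
split=> [[w [g [pw hg ->]]]|[theta [pw pa] ->]]; last first.
  exists (fun i => theta (inl i)),
    (fun i j x => \sum_l theta (inr (i, j, l)) * bin_density l x).
  split => //; last by apply/funext => x; rewrite hist_coef.
  by move=> i j; apply/histogram1P; exists (fun l => theta (inr (i, j, l))).
have /choice[h hP] : forall ij : 'I_k * 'I_d, exists h : 'I_b -> R,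
    prob_vector h /\ g ij.1 ij.2 = fun x => \sum_l h l * bin_density l x.
  by move=> [i j]; have /histogram1P[h ? ?] := hg i j; exists h.
exists (fun u => match u with inl i => w i | inr (i, j, l) => h (i, j) l end).
  by split => // i j; have [] := hP (i, j).
apply/funext => x; rewrite hist_coef; apply: eq_bigr => i _; congr (_ * _).
by apply: eq_bigr => j _; have [_ /= ->] := hP (i, j).
Qed.

End Representation.

(** * Existence of a best approximation *)

Section BestApproximation.
Variables (R : realType) (d b k : nat).
Hypotheses (b_gt0 : (0 < b)%N) (k_gt0 : (0 < k)%N).
Variable p : density (R := R) d.
Local Notation space := (prod_topology (fun _ : index d b k => R)).

Lemma L1_dist_hist_fin (c : cell d b -> R) :
  L1_dist p (hist c) \is a fin_num.
Proof.
rewrite ge0_fin_numE; last exact: L1_dist_ge0.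
have mz : measurable_fun (@cube R d) (hist (fun _ : cell d b => 0 : R)).
  exact: measurable_hist.
have := L1_dist_triangle (measurable_pdf p) mz (@measurable_hist _ _ _ c _).
move=> /le_lt_trans; apply; apply: lte_add_pinfty.
  rewrite /L1_dist (eq_integral (EFin \o p)) ?integral_pdf ?ltry// => x.
  rewrite inE => cx /=; rewrite /hist big1 ?subr0 ?ger0_norm ?pdf_ge0// => a _.
  by rewrite mul0r.
exact: le_lt_trans (L1_dist_hist_le b_gt0 _ _) (ltry _).
Qed.

Lemma fine_L1_dist_lipschitz (c c' : cell d b -> R) :
  `|fine (L1_dist p (hist c)) - fine (L1_dist p (hist c'))|
  <= \sum_a `|c a - c' a|.
Proof.
have le1 e e' : fine (L1_dist p (hist e)) <=
    fine (L1_dist p (hist e')) + \sum_(a : cell d b) `|e' a - e a|.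
  rewrite -lee_fin EFinD !fineK ?L1_dist_hist_fin//.
  have := L1_dist_triangle (measurable_pdf p) (@measurable_hist _ _ _ e' _)
    (@measurable_hist _ _ _ e _).
  by move=> /le_trans; apply; rewrite leeD2l// L1_dist_hist_le.
have h1 := le1 c c'; have h2 := le1 c' c.
rewrite (eq_bigr _ (fun a _ => distrC (c' a) (c a))) in h1.
by rewrite ler_norml; apply/andP; split; lra.
Qed.

Lemma coord_continuous u : continuous (fun theta : space => theta u).
Proof. exact: (@proj_continuous (index d b k) (fun=> R) u). Qed.

Lemma sum_continuous (X : topologicalType) I (r : seq I) (F : I -> X -> R) :
  (forall i, continuous (F i)) -> continuous (fun x => \sum_(i <- r) F i x).
Proof. by move=> cF; apply: continuous_big => //; exact: add_continuous. Qed.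

Lemma prod_continuous (X : topologicalType) I (r : seq I) (F : I -> X -> R) :
  (forall i, continuous (F i)) -> continuous (fun x => \prod_(i <- r) F i x).
Proof. by move=> cF; apply: continuous_big => //; exact: mul_continuous. Qed.

(** A criterion on an arbitrary space, so that the error need only be controlled
    through finitely many continuous coordinates. *)
Lemma continuous_of_l1_bound (X : topologicalType) (I : finType) (f : X -> R)
    (c : I -> X -> R) : (forall i, continuous (c i)) ->
  (forall x y, `|f x - f y| <= \sum_i `|c i x - c i y|) -> continuous f.
Proof.
move=> cc fc x0; apply/cvgrPdist_le => e e0.
have cD i : continuous (fun x => `|c i x0 - c i x|).
  move=> x; apply: cvg_norm; apply: cvgB; first exact: cvg_cst.
  exact: cc.
have : \sum_i `|c i x0 - c i x| @[x --> x0] --> (0 : R).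
  rewrite -[X in _ --> X](_ : \sum_i `|c i x0 - c i x0| = 0).
    exact: (sum_continuous (r := index_enum I) cD).
  by rewrite big1// => i _; rewrite subrr normr0.
by move=> /cvgr_le/(_ _ e0); apply: filterS => x; exact: le_trans (fc _ _).
Qed.

Lemma coef_continuous (a : cell d b) :
  continuous (fun theta : space => coef (k := k) theta a).
Proof.
have cP i : continuous (fun theta : space => \prod_j theta (inr (i, j, a j)) : R).
  by apply: prod_continuous => j; exact: coord_continuous.
have cT i : continuous (fun theta : space =>
    theta (inl i) * \prod_j theta (inr (i, j, a j)) : R).
  by move=> theta; exact: (cvgM (@coord_continuous (inl i) theta) (cP i theta)).
exact: (sum_continuous (r := index_enum _) cT).
Qed.

Lemma fine_L1_dist_continuous : continuous
  (fun theta : space => fine (L1_dist p (hist (coef (k := k) theta)))).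
Proof.
apply: (continuous_of_l1_bound coef_continuous) => theta theta'.
exact: fine_L1_dist_lipschitz.
Qed.

(** A closed subset of the cube [[0, 1]^index], which is compact by Tychonoff's
    theorem. *)
Lemma compact_valid : compact [set theta : space | valid (k := k) theta].
Proof.
pose unit_box := [set theta : space | forall u, `[0, 1]%classic (theta u)].
pose W := [set theta : space | \sum_i theta (inl i) = 1].
pose A (ij : 'I_k * 'I_d) :=
  [set theta : space | \sum_l theta (inr (ij.1, ij.2, l)) = 1].
have -> : [set theta : space | valid (k := k) theta] =
    unit_box `&` (W `&` \bigcap_ij A ij).
  apply/seteqP; split => theta.
    move=> [pw pa]; split; [|split].
    - move=> [i|[[i j] l]]; rewrite /= in_itv/=.
        by rewrite pw.1 (prob_vector_le1 _ pw).
      by rewrite (pa i j).1 (prob_vector_le1 _ (pa i j)).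
    - exact: pw.2.
    - by move=> [i j] _; exact: (pa i j).2.
  move=> [bx [w1 a1]]; have th0 u : 0 <= theta u.
    by have := bx u; rewrite /= in_itv/= => /andP[].
  by split => [|i j]; split => //; exact: (a1 (i, j)).
apply: compact_closedI.
  apply: (@tychonoff _ (fun _ : index d b k => R) (fun=> `[0, 1]%classic)) => _.
  exact: segment_compact.
apply: closedI.
  apply: (@preimage_closed _ _ (fun theta : space => \sum_i theta (inl i)) [set y | y = 1]).
    by move=> theta _; apply: sum_continuous => i; exact: coord_continuous.
  exact: closed_eq.
apply: closed_bigI => -[i j] _.
apply: (@preimage_closed _ _ (fun theta : space => \sum_l theta (inr (i, j, l))) [set y | y = 1]).
  by move=> theta _; apply: sum_continuous => l; exact: coord_continuous.
exact: closed_eq.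
Qed.

(** The distance to [p] is a continuous function of the parameters, which range
    over a compact set. *)
Lemma best_approximation : exists2 theta : params R d b k, valid theta &
  L1_dist p (hist (coef theta)) = L1_error (multiview_histogram d b k) p.
Proof.
have [|||theta] := @compact_EVT_min space R
  (fun theta => fine (L1_dist p (hist (coef (k := k) theta))))
  [set theta | valid (k := k) theta].
- by have [theta v] := valid_exists R d b_gt0 k_gt0; exists theta.
- exact: compact_valid.
- by apply: continuous_subspaceT; exact: fine_L1_dist_continuous.
rewrite inE => v minv; exists theta => //; apply/eqP; rewrite eq_le; apply/andP; split.
  apply: le_ereal_inf_tmp => _ [q /multiview_histogramP[theta' v' ->] <-].
  rewrite -(fineK (L1_dist_hist_fin (coef theta))).
  rewrite -(fineK (L1_dist_hist_fin (coef theta'))) lee_fin.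
  by apply: minv; rewrite inE.
apply: ereal_inf_lbound; exists (hist (coef theta)) => //.
by apply/multiview_histogramP; exists theta.
Qed.

End BestApproximation.

(** * Samples reduced to finitely many classes *)

Section FiniteSamples.
Context {disp : measure_display} {T : measurableType disp} {R : realType}.
Variables (C : finType) (g : T -> C).
Hypothesis mg : forall a, measurable (g @^-1` [set a]).

(** The word of the classes of the sample points. It takes finitely many values,
    so every event or estimator that depends on the sample through it is
    automatically measurable. *)
Definition sample_word n (s : n.-tuple T) : {ffun 'I_n -> C} :=
  [ffun i => g (tnth s i)].

Lemma sample_word_box n (w : {ffun 'I_n -> C}) :
  [set s : n.-tuple T | forall i, (g @^-1` [set w i]) (tnth s i)] =
  @sample_word n @^-1` [set w].
Proof.
apply/seteqP; split => s /= h; first by apply/ffunP => i; rewrite ffunE h.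
by move=> i; rewrite -h ffunE.
Qed.

Lemma measurable_sample_word n (w : {ffun 'I_n -> C}) :
  measurable (@sample_word n @^-1` [set w]).
Proof.
rewrite -sample_word_box.
exact: (measurable_box (A := fun i => g @^-1` [set w i])).
Qed.

(** Turns the probability of an event on words into a finite sum, which is the
    form in which the tail bounds above are stated. *)
Lemma power_measure_sample_word (mu : {sigma_finite_measure set T -> \bar R})
    n (F : pred {ffun 'I_n -> C}) :
  power_measure mu n [set s | F (sample_word s)] =
  (\sum_(w | F w) \prod_i mu (g @^-1` [set w i]))%E.
Proof.
have -> : [set s : n.-tuple T | F (sample_word s)] =
    \bigcup_(w in [set` F]) (@sample_word n @^-1` [set w]).
  by apply/seteqP; split => [s Fs|s [w Fw /= ->] //]; exists (sample_word s).
rewrite measure_fin_bigcup//=.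
- rewrite -(@bigfs _ _ _ _ (index_enum _))/=; first last.
  + by move=> w _; rewrite mem_index_enum.
  + exact: index_enum_uniq.
  apply: eq_bigr => w _; rewrite -sample_word_box.
  exact: (power_measure_box mu (A := fun i => g @^-1` [set w i])).
- by move=> w w1 _ _ [s [/= e1 e2]]; rewrite -e1 -e2.
- by move=> w _; exact: measurable_sample_word.
Qed.

End FiniteSamples.

(** * The estimator and its error *)

Section Estimator.
Variables (R : realType) (d b k : nat).
Hypotheses (b_gt0 : (0 < b)%N) (k_gt0 : (0 < k)%N).
Local Notation T := (d.-tuple (measurableTypeR R)).
Local Notation code := (code d b k).

Variable a0 : cell d b.

(** Points outside the unit cube, which no density charges, go to the arbitrary
    cell [a0]. *)
Definition cell_of (x : T) : cell d b := odflt a0 [pick a | `[< box a x >]].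

Lemma cell_of_preimage a : cell_of @^-1` [set a] =
  box a `|` (if a == a0 then ~` @cube R d else set0).
Proof.
apply/seteqP; split => x /=; rewrite /cell_of; case: pickP => /= [a' /asboolP ax|nx].
- by move=> <-; left.
- move=> <-; rewrite eqxx; right => cx; have [a' ax] := box_cover b_gt0 cx.
  by have /asboolP := nx a'.
- move=> [|]; first exact: (box_inj b_gt0 ax).
  by case: eqP => // _ []; exact: (box_cube b_gt0 ax).
- move=> [ax|]; first by have /asboolP := nx a.
  by case: eqP.
Qed.

Lemma measurable_cell_of a : measurable (cell_of @^-1` [set a]).
Proof.
rewrite cell_of_preimage; apply: measurableU; first exact: measurable_cell_box.
by case: ifP => // _; apply: measurableC; exact: measurable_cube.
Qed.

Lemma law_cell_of (p : density d) a :
  law p (cell_of @^-1` [set a]) = (cell_mass p a)%:E.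
Proof.
rewrite cell_massE// /law cell_of_preimage setIUl; congr (\int[_]_(x in _) _)%E.
by case: ifP; rewrite ?setICl ?set0I setU0.
Qed.

Variables (rep : code -> params R d b k) (t0 : code).
Hypothesis rep_valid : forall t, valid (rep t).

Definition net_coef (t : code) : cell d b -> R := coef (rep t).

Definition word_estimate n (w : {ffun 'I_n -> cell d b}) : T -> R :=
  hist (net_coef (min_distance net_coef t0 w)).

Definition multiview_estimate n (s : n.-tuple T) : T -> R :=
  word_estimate (sample_word cell_of s).

Lemma net_coef_prob t : prob_vector (net_coef t).
Proof. exact: coef_prob. Qed.

Lemma estimator_multiview n :
  estimator (multiview_histogram d b k) (@multiview_estimate n).
Proof.
split=> [s|].
  by apply/multiview_histogramP; exists (rep (min_distance net_coef t0 (sample_word cell_of s))).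
pose A w : set (n.-tuple T) := @sample_word _ _ _ cell_of n @^-1` [set w].
rewrite (_ : (fun sx => _) = fun sx : n.-tuple T * T =>
    \sum_w \1_(A w) sx.1 * word_estimate w sx.2).
  apply: measurable_sum => w; apply: measurable_funM.
    apply: (measurableT_comp (f := \1_(A w) : n.-tuple T -> R)) => //.
    apply: measurable_indic; apply: measurable_sample_word.
    exact: measurable_cell_of.
  apply: (measurableT_comp (f := word_estimate w)) => //.
  exact: measurable_hist.
apply/funext => -[s x] /=; rewrite (bigD1 (sample_word cell_of s))//= big1 ?addr0.
  by rewrite indicE mem_set// mul1r.
move=> w ws; rewrite indicE memNset ?mul0r//.
by move=> e; rewrite /A/= in e; rewrite -e eqxx in ws.
Qed.

Variables (delta : R).
Hypothesis net_dense : forall theta : params R d b k, valid theta -> exists t,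
  \sum_a `|net_coef t a - coef theta a| <= delta.

(** Let [u] be a member of the net near the best approximation. The estimate
    differs from [u] by at most twice the error of [u] plus [4 t], and one more
    error of [u] leads to [p]: this is the constant 3. *)
Lemma word_estimate_error (p : density d) n (w : {ffun 'I_n -> cell d b}) (t : R) :
  max_deviation net_coef (cell_mass p) w <= t ->
  (L1_dist (word_estimate w) p <=
   3%:E * L1_error (multiview_histogram d b k) p + (3 * delta + 4 * t)%:E)%E.
Proof.
move=> dev; have [theta v <-] := best_approximation b_gt0 k_gt0 p.
have [u uP] := net_dense v.
set m := min_distance net_coef t0 w.
have mp := measurable_pdf p.
have mh c : measurable_fun (@cube R d) (@hist R d b c) by exact: measurable_hist.
have oracle := min_distance_oracle t0 net_coef_prob w u (cell_mass_prob b_gt0 p).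
have h1 := l1_cell_mass_le b_gt0 p (net_coef_prob u).1.
have h2 : (L1_dist (hist (net_coef u)) p <= delta%:E + L1_dist p (hist (coef theta)))%E.
  rewrite [X in (_ <= _ + X)%E]L1_distC.
  apply: le_trans (L1_dist_triangle (mh _) (mh (coef theta)) mp) _.
  rewrite leeD2r//; apply: le_trans (L1_dist_hist_le b_gt0 _ _) _.
  by rewrite lee_fin.
have h3 : (L1_dist (word_estimate w) p <=
    (\sum_a `|net_coef m a - net_coef u a|)%:E + L1_dist (hist (net_coef u)) p)%E.
  apply: le_trans (L1_dist_triangle (mh _) (mh (net_coef u)) mp) _.
  by rewrite leeD2r//; exact: (L1_dist_hist_le b_gt0).
move: h1 h2 h3; rewrite [L1_dist _ p in X in X -> _]L1_distC.
rewrite [L1_dist (hist (net_coef u)) p]L1_distC.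
rewrite -(fineK (L1_dist_hist_fin b_gt0 p (net_coef u))).
rewrite -(fineK (L1_dist_hist_fin b_gt0 p (coef theta))) -EFinM -!EFinD !lee_fin.
move=> h1 h2 /le_trans; apply; rewrite lee_fin.
by move: oracle; rewrite -/m; lra.
Qed.

(** By [word_estimate_error], a large error forces a large deviation of the cell
    frequencies; the bound does not depend on [p]. *)
Lemma estimate_error_tail (p : density d) n (t eps : R) : (0 < n)%N ->
  0 < t -> t <= 2 -> 3 * delta + 4 * t <= eps ->
  (iid_law p n [set s | 3%:E * L1_error (multiview_histogram d b k) p + eps%:E
                        < L1_dist (multiview_estimate s) p] <=
   ((#|code| ^ 2)%:R * (2 * expR (- (n%:R * (t ^+ 2 / 8)))))%:E)%E.
Proof.
move=> n_gt0 t_gt0 t_le2 te.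
have pm := cell_mass_prob b_gt0 p.
pose F (w : {ffun 'I_n -> cell d b}) : bool :=
  (3%:E * L1_error (multiview_histogram d b k) p + eps%:E < L1_dist (word_estimate w) p)%E.
have := power_measure_sample_word measurable_cell_of (law p) F.
rewrite /iid_law /F => ->; rewrite -/F.
rewrite (eq_bigr (fun w : {ffun 'I_n -> cell d b} =>
  (\prod_i cell_mass p (w i))%:E)) => [|w _]; last first.
  by rewrite -prodEFin; apply: eq_bigr => i _; exact: law_cell_of.
rewrite sumEFin lee_fin.
apply: le_trans (max_deviation_tail net_coef n_gt0 pm t_gt0 t_le2).
rewrite big_mkcond [leRHS]big_mkcond/=; apply: ler_sum => w _.
have P0 : 0 <= \prod_i cell_mass p (w i) by apply: prodr_ge0 => i _; exact: pm.1.
case: ifPn => [Fw|_]; last by case: ifP.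
rewrite ifT// ltNge; apply/negP => /(word_estimate_error (p := p)) h.
move: Fw; rewrite /F ltNge => /negP; apply; apply: le_trans h _.
by rewrite leeD2l// lee_fin.
Qed.

End Estimator.

(** * Rates and consistency *)

Section Rates.
Variable R : realType.

Lemma sqr_succ_le_cube m : (1 < m)%N -> ((m ^ 2).+1 <= m ^ 3)%N.
Proof.
move=> m1; rewrite (expnS m 2); apply: (@leq_trans (2 * m ^ 2)); last by rewrite leq_mul2r m1 orbT.
by rewrite mul2n -addnn -addn1 leq_add2l expn_gt0 ltnW.
Qed.

Lemma natr_expn_expR m e : (0 < m)%N -> (m ^ e)%:R = expR (e%:R * ln m%:R) :> R.
Proof. by move=> m0; rewrite natrX expRM_natl lnK// posrE ltr0n. Qed.

(** From [m ^ 2 + 1 <= m ^ 3], the number of codes is at most the exponential of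
    [3 (k log k + d b k log b)]; the square doubles the constant. *)
Lemma card_code_le d b k : (0 < d)%N -> (1 < b)%N -> (1 < k)%N ->
  (#|code d b k| ^ 2)%:R <=
  expR (6 * d%:R * (b%:R * k%:R * ln b%:R + k%:R * ln k%:R)) :> R.
Proof.
move=> d0 b1 k1; have b0 := ltnW b1; have k0 := ltnW k1.
have card_le : (#|code d b k| <= k ^ (3 * k) * b ^ (3 * (k * d * b)))%N.
  rewrite card_code (expnM k) (expnM b).
  by apply: leq_mul; rewrite leq_exp2r ?muln_gt0 ?k0 ?d0 ?b0// sqr_succ_le_cube.
apply: (@le_trans _ _ (((k ^ (3 * k) * b ^ (3 * (k * d * b))) ^ 2)%:R)).
  by rewrite ler_nat leq_exp2r.
rewrite natrX natrM !natr_expn_expR// -expRD -expRM_natl ler_expR !natrM.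
have lk0 : 0 <= ln k%:R :> R by rewrite ln_ge0// ler1n.
have d1 : 1 <= d%:R :> R by rewrite ler1n.
rewrite -subr_ge0 [X in 0 <= X](_ : _ =
  6 * (k%:R * ln k%:R) * (d%:R - 1)); last by ring.
by rewrite mulr_ge0 ?mulr_ge0 ?subr_ge0.
Qed.

Lemma near_invr_le (u : nat -> nat) (c e : R) : 0 <= c -> 0 < e ->
  u n @[n --> \oo] --> \oo -> \forall n \near \oo, c / (u n)%:R <= e.
Proof.
move=> c0 e0 u_oo; pose M := (Num.truncn (c / e)).+1.
have : \forall n \near \oo, (M <= u n)%N by exact: u_oo (nbhs_infty_ge M).
apply: filterS => n Mu; have u0 : 0 < (u n)%:R :> R.
  by rewrite ltr0n (leq_trans _ Mu).
rewrite ler_pdivrMr// mulrC -ler_pdivrMr//; apply: (@le_trans _ _ M%:R).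
  by rewrite ltW// truncnS_gt.
by rewrite ler_nat.
Qed.

End Rates.

(** The density of the only cell of the partition with one bin per axis. It shows
    that the supremum over all densities is not over the empty set. *)
Definition uniform_density (R : realType) d : density (R := R) d :=
  let a : cell d 1 := [ffun=> ord0] in
  Density (@measurable_cell_density R d 1 a _)
    (fun x _ => cell_density_ge0 a x) (@integral_cell_density R d 1 (ltn0Sn 0) a).

Theorem theorem2p1 (R : realType) (d : nat) (d_gt0 : (0 < d)%N)
    (b k : nat -> nat)
    (b_gt0 : forall n, (0 < b n)%N) (k_gt0 : forall n, (0 < k n)%N)
    (b_oo : b n @[n --> \oo] --> \oo) (k_oo : k n @[n --> \oo] --> \oo)
    (rate : (n%:R / ((b n)%:R * (k n)%:R * ln (b n)%:R
                     + (k n)%:R * ln (k n)%:R) : R) @[n --> \oo] --> +oo) :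
  (forall n (p : density (R := R) d),
     exists2 q, multiview_histogram d (b n) (k n) q
       & L1_dist p q = L1_error (multiview_histogram d (b n) (k n)) p) /\
  exists V : forall n, n.-tuple (d.-tuple (measurableTypeR R)) -> d.-tuple (measurableTypeR R) -> R,
    (forall n, estimator (multiview_histogram d (b n) (k n)) (V n)) /\
    (forall eps : R, 0 < eps ->
       ereal_sup (range (fun p : density (R := R) d =>
         iid_law p n
           [set s | (3%:E * L1_error (multiview_histogram d (b n) (k n)) p
                     + eps%:E < L1_dist (V n s) p)%E]))
       @[n --> \oo] --> 0%E).
Proof.
split=> [n p|].
  have [theta v e] := best_approximation (b_gt0 n) (k_gt0 n) p.
  by exists (hist (coef theta)) => //; apply/multiview_histogramP; exists theta.
pose rep n := projT1 (cid (net_exists R d (b_gt0 n) (k_gt0 n))).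
have repP n := projT2 (cid (net_exists R d (b_gt0 n) (k_gt0 n))).
pose a0 n : cell d (b n) := [ffun=> Ordinal (b_gt0 n)].
pose t0 n : code d (b n) (k n) := ([ffun=> ord0], [ffun=> ord0]).
exists (fun n => @multiview_estimate R d (b n) (k n) (a0 n) (rep n) (t0 n) n).
split=> [n|eps eps0].
  by apply: estimator_multiview => //; exact: (repP n).1.
set f := fun n => ereal_sup _.
(* Half of [eps] pays for the deviation term [4 * t], the other half for three
   times the resolution of the net; [2] is the range of the tail bound. *)
pose t := Num.min 2 (eps / 8).
have t_gt0 : 0 < t by rewrite lt_min ltr0n divr_gt0.
have t_le2 : t <= 2 by rewrite ge_min lexx.
have t_eps : 4 * t <= eps / 2.
  have : t <= eps / 8 by rewrite ge_min lexx orbT.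
  lra.
have d1 : 1 <= d%:R :> R by rewrite ler1n.
(* Of the exponent [n t^2 / 8 = 2 n c], one half absorbs the size of the net. *)
pose c := t ^+ 2 / 16.
have c_gt0 : 0 < c by rewrite divr_gt0// exprn_gt0.
have e12 : 0 < eps / 12 by rewrite divr_gt0.
have f_ge0 n : (0 <= f n)%E.
  apply: le_trans (ereal_sup_ubound _); last by exists (uniform_density R d).
  exact: measure_ge0.
have rate_ge A : \forall n \near \oo, A <= n%:R /
    ((b n)%:R * (k n)%:R * ln (b n)%:R + (k n)%:R * ln (k n)%:R) :> R.
  by move: A; exact/cvgryPge.
have f_le : \forall n \near \oo, (f n <= (2 * expR (- c) ^+ n)%:E)%E.
  near=> n.
  have n_gt0 : (0 < n)%N by near: n; exact: nbhs_infty_gt.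
  have b1 : (1 < b n)%N by near: n; exact: b_oo (nbhs_infty_gt 1).
  have k1 : (1 < k n)%N by near: n; exact: k_oo (nbhs_infty_gt 1).
  have db : d%:R / (b n)%:R <= eps / 12.
    by near: n; apply: near_invr_le => //; exact: le_trans d1.
  have ik : 1 / (k n)%:R <= eps / 12 by near: n; exact: near_invr_le.
  pose S : R := (b n)%:R * (k n)%:R * ln (b n)%:R + (k n)%:R * ln (k n)%:R.
  have nS : 6 * d%:R / c <= n%:R / S.
    rewrite /S; near: n; exact: rate_ge.
  have S0 : 0 <= S.
    by rewrite addr_ge0// mulr_ge0// ?mulr_ge0// ln_ge0// ler1n.
  have dS : 6 * d%:R * S <= n%:R * c.
    move: S0; rewrite le_eqVlt => /predU1P[<-|S_gt0].
      by rewrite mulr0 mulr_ge0// ltW.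
    by move: nS; rewrite ler_pdivrMr// mulrAC ler_pdivlMr// mulrC.
  apply: ge_ereal_sup => _ [p _ <-].
  have err_le : 3 * ((k n)%:R^-1 + d%:R / (b n)%:R) + 4 * t <= eps.
    by rewrite div1r in ik; lra.
  have tail := estimate_error_tail (b_gt0 n) (k_gt0 n) (a0 n) (t0 n) (repP n).1
    (repP n).2 p n_gt0 t_gt0 t_le2 err_le.
  apply: le_trans tail _.
  rewrite lee_fin mulrCA ler_wpM2l//.
  apply: (@le_trans _ _ (expR (6 * d%:R * S) * expR (- (n%:R * (t ^+ 2 / 8))))).
    by rewrite ler_wpM2r ?expR_ge0// card_code_le.
  rewrite -expRD -expRM_natl ler_expR.
  by move: dS; rewrite /c; lra.
apply: (@squeeze_cvge _ _ _ _ (cst 0%E) f (fun n => (2 * expR (- c) ^+ n)%:E)).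
- by near=> n; rewrite f_ge0/=; near: n.
- exact: cvg_cst.
- apply: cvg_EFin; first by near=> n.
  rewrite -(mulr0 2); apply: cvgMr; apply: cvg_expr.
  by rewrite ger0_norm ?expR_ge0// expR_lt1 oppr_lt0.
Unshelve. all: by end_near. Qed.
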